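(* Let $N\in\mathbb N$ and let $X$ be a complete metric space. The set of systems of mappings $(w_1,\ldots,w_N)\in(\mathcal M(X))^N$ which satisfy the strong Markov property (SMP) is a $G_\delta$ set in the topology $\mathcal B_N$ on $(\mathcal M(X))^N$.
   Context: $\mathbb N=\{1,2,\ldots\}$, and $d$ is the distance in $X$. A mapping $w:X\to X$ is contracting if $\sigma(w)=\sup_{x\neq y\in X}\frac{d(w(x),w(y))}{d(x,y)}<1$. $\mathcal M(X)$ denotes the set of all contracting homeomorphisms of $X$ onto itself. For $(w_1,\ldots,w_N)\in(\mathcal M(X))^N$, the attractor $A=A(w_1,\ldots,w_N)$ is the unique non-empty compact subset of $X$ with $A=\bigcup_{i=1}^N w_i(A)$. Let $\Sigma=\{1,\ldots,N\}$, and for $\mathbf i=(i_1,\ldots,i_n)\in\Sigma^n$ let $w_{\mathbf i}=w_{i_1}\circ\cdots\circ w_{i_n}$. A system $(w_1,\ldots,w_N)\in(\mathcal M(X))^N$ satisfies the strong Markov property (SMP) if for every $n\in\mathbb N$ there is an open set $\mathcal O_n\subset X$ such that (1) $\overline{\mathcal O_n\cap A}=A$; and (2) $w_{\mathbf i}(\mathcal O_n)\cap w_{\mathbf j}(\mathcal O_n)=\emptyset$ for all $\mathbf i\neq\mathbf j\in\Sigma^n$. A sequence $\{w^m\}_{m\in\mathbb N}\subset\mathcal M(X)$ converges strongly pointwise to $w\in\mathcal M(X)$ if $\lim_{m\to\infty}w^m(x)=w(x)$ for every $x\in X$ and $\sup_{m\in\mathbb N}\sigma(w^m)<1$. The topology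 $\mathcal B_N$ on $(\mathcal M(X))^N$ is defined by declaring $C\subset(\mathcal M(X))^N$ closed if for every sequence $\{(w_1^m,\ldots,w_N^m)\}_{m\in\mathbb N}\subset C$ such that $\{w_i^m\}_{m}$ converges strongly pointwise to some $w_i\in\mathcal M(X)$ for each $i=1,\ldots,N$, one has $(w_1,\ldots,w_N)\in C$ (the empty set is closed). *)

(* Defs.v *)
From HB Require Import structures.
From mathcomp Require Import all_boot all_order all_algebra.
From mathcomp Require Import all_classical all_reals all_analysis.

Set Implicit Arguments.
Unset Strict Implicit.
Unset Printing Implicit Defensive.

Import Order.TTheory GRing.Theory Num.Theory.
Import numFieldNormedType.Exports.

Local Open Scope classical_set_scope.
Local Open Scope ring_scope.

(* The property [cauchy_cvg] of the library's [completeType], stated as a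
   predicate because [completeType] also asks for a distinguished point. *)
Definition complete_space (X : uniformType) : Prop :=
  forall F : set_system X, ProperFilter F -> cauchy F -> exists x : X, F --> x.

Definition homeomorphism (X Y : topologicalType) (f : X -> Y) : Prop :=
  continuous f /\
  exists g : Y -> X, [/\ cancel f g, cancel g f & continuous g].

Section contracting_maps.
Context {R : realType} {X : metricType R}.

(* The supremum is taken in \bar R, where the unbounded case is +oo; the
   real-valued [sup] is 0 on unbounded sets, which would make non-Lipschitz maps
   contracting. On a space with at most one point the value is -oo. *)
Definition sigma (w : X -> X) : \bar R :=
  ereal_sup [set (mdist (w p.1) (w p.2) / mdist p.1 p.2)%:E
            | p in [set p : X * X | p.1 <> p.2]].

Definition contracting (w : X -> X) : Prop := (sigma w < 1)%E.

End contracting_maps.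

Record contr_homeo (R : realType) (X : metricType R) := ContrHomeo {
  contr_homeo_fun :> X -> X;
  contr_homeo_homeo : homeomorphism contr_homeo_fun;
  contr_homeo_contracting : contracting contr_homeo_fun }.

(* A named type, so that the topology it carries is the one defined below from
   strongly pointwise convergent sequences and not a product topology. *)
Definition contr_system (R : realType) (X : metricType R) (N : nat) :=
  'I_N -> contr_homeo X.

Section systems.
Context {R : realType} {X : metricType R} {N : nat}.
Implicit Types (w : contr_system X N) (A : set X).

Definition is_attractor w A : Prop :=
  [/\ A !=set0, compact A & A = \bigcup_(i : 'I_N) (w i @` A)].

(* In a nonempty complete space, and for N > 0, exactly one set satisfies
   [is_attractor w]; the default value set0 is then irrelevant. *)
Definition attractor w : set X := xget set0 (is_attractor w).

(* w_(i_1, ..., i_n) = w_(i_1) \o ... \o w_(i_n) *)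
Definition word_map w (s : seq 'I_N) : X -> X :=
  foldr (fun i f => w i \o f) id s.

Definition SMP w : Prop :=
  forall n : nat, (0 < n)%N ->
  exists O : set X,
    [/\ open O,
        closure (O `&` attractor w) = attractor w &
        forall i j : n.-tuple 'I_N, i <> j ->
          (word_map w i @` O) `&` (word_map w j @` O) = set0].

Definition strongly_pointwise_cvg (u : nat -> contr_homeo X)
    (v : contr_homeo X) : Prop :=
  (forall x : X, u m x @[m --> \oo] --> v x) /\
  (ereal_sup (range (fun m => sigma (u m))) < 1)%E.

Definition BN_closed (C : set (contr_system X N)) : Prop :=
  forall (u : nat -> contr_system X N) w,
    (forall m, C (u m)) ->
    (forall i, strongly_pointwise_cvg (fun m => u m i) (w i)) ->
    C w.

Definition BN_open (U : set (contr_system X N)) : Prop := BN_closed (~` U).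

Lemma strongly_pointwise_cvg_sub (u : nat -> contr_homeo X) v (f : nat -> nat) :
  (forall n, (n <= f n)%N) ->
  strongly_pointwise_cvg u v -> strongly_pointwise_cvg (u \o f) v.
Proof.
move=> fge [uv su]; split.
  move=> x; apply: (cvg_comp f (fun m => u m x)) (uv x).
  move=> P [k _ kP]; exists k => // n /= kn; apply: kP => /=.
  exact: leq_trans kn (fge n).
apply: le_lt_trans su; apply: ereal_sup_le => _ [n _ <-].
by exists (f n).
Qed.

Lemma BN_openT : BN_open setT.
Proof. by move=> u w /(_ 0%N) []. Qed.

Lemma BN_openI : setI_closed BN_open.
Proof.
move=> A B oA oB u w uAB uw; rewrite setCI.
have [[k kA]|nA] :=
    pselect (exists k, forall n, (k <= n)%N -> (~` B) (u n)).
  right; apply: (oB (fun n => u (n + k)%N)).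
    by move=> m; apply: kA; exact: leq_addl.
  move=> i; apply: (@strongly_pointwise_cvg_sub (u^~ i) _ (addn^~ k)) => //.
  by move=> n; exact: leq_addr.
have /choice[f fP] : forall k, exists n, (k <= n)%N /\ (~` A) (u n).
  move=> k; apply: contrapT => nk; apply: nA; exists k => n kn.
  have := uAB n; rewrite setCI => -[nAn|//].
  by case: nk; exists n.
left; apply: (oA (u \o f)) => [m|i]; first by have [] := fP m.
apply: (@strongly_pointwise_cvg_sub (u^~ i)) => // n.
by have [] := fP n.
Qed.

Lemma BN_open_bigU (I : Type) (f : I -> set (contr_system X N)) :
  (forall i, BN_open (f i)) -> BN_open (\bigcup_i f i).
Proof.
move=> fo u w uf uw; rewrite setC_bigcup => i _.
by apply: (fo i u) => // m; have := uf m; rewrite setC_bigcup; exact.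
Qed.

HB.instance Definition _ := gen_eqMixin (contr_system X N).
HB.instance Definition _ := gen_choiceMixin (contr_system X N).
HB.instance Definition _ := isOpenTopological.Build (contr_system X N)
  BN_openT BN_openI BN_open_bigU.

Lemma closed_BNE (C : set (contr_system X N)) : closed C <-> BN_closed C.
Proof.
by rewrite -openC; split => [oC|cC]; [have : BN_open (~` C) by []|
  change (BN_open (~` C))]; rewrite /BN_open setCK.
Qed.

End systems.

(* Main.v *)
Require Import Defs.
From mathcomp Require Import all_boot all_order all_algebra.
From mathcomp Require Import all_classical all_reals all_analysis borel_hierarchy.
From mathcomp Require Import ring lra.

(** Let A be the attractor of w.  Call a point x of A n-separated when, for some
    r > 0, d(w_i(x), w_j(y)) >= r for all words i <> j of length n and all y in
    A: the copy of x in the cell w_i(A) stays away from every other cell of the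
    same level.  Let U_n be the set of systems that have an n-separated point.
    The theorem follows from two facts: SMP holds exactly when w lies in U_n for
    every n >= 1, and every U_n is open.

    SMP implies U_n ([SMP_has_separated_point]).  A point x of O_n in A is
    n-separated: w_i(O_n) is an open neighbourhood of w_i(x) because w_i is a
    homeomorphism, and if a point w_j(y), y in A, were very close to w_i(x), then
    so would be w_j(z) for some z in O_n close to y, against disjointness.

    All the U_n imply SMP ([has_separated_point_SMP]).  If x is
    (n+m)-separated, then w_k(x) is n-separated for every word k of length m
    ([separated_word_map]), because i <> j remain distinct when they are
    extended to length n+m.  Letting m grow, the n-separated points are dense in
    A ([separated_dense]).  The union of the balls of centre x and radius r, over
    the points x that are n-separated by 2r, serves as O_n: all word maps are
    nonexpansive, so the images of two such balls under distinct words cannot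
    meet.

    U_n is open ([open_has_separated_point]).  Along a strongly pointwise
    convergent sequence of systems the Lipschitz constants are bounded by some
    c < 1, so word maps converge uniformly on compact sets
    ([nonexpansive_cvg_uniform]) and the attractors converge in the Hausdorff
    distance ([attractor_approx]).  A point of the m-th attractor close to an
    n-separated point of the limit is then n-separated, with half the constant,
    once m is large.  Hence the complement of U_n is sequentially closed.

    The attractor exists because X is complete: it is the image of the compact
    space of infinite words under the address map ([attractor_exists]). *)

Set Implicit Arguments.
Unset Strict Implicit.
Unset Printing Implicit Defensive.

Import Order.TTheory GRing.Theory Num.Theory.
Import numFieldNormedType.Exports.

Local Open Scope classical_set_scope.
Local Open Scope ring_scope.

(** * Contraction ratios *)

Lemma geometric_small (R : realType) (c M e : R) : 0 <= c < 1 -> 0 < e ->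
  exists n, c ^+ n * M <= e.
Proof.
move=> /andP[c0 c1] e0.
have := @cvg_geometric R M c; rewrite ger0_norm// => /(_ c1).
move=> /cvgrPdist_le/(_ e e0)[n _ /(_ n (leqnn n))].
rewrite /= /geometric /= sub0r normrN => h; exists n.
by rewrite mulrC (le_trans (ler_norm _)).
Qed.

(** The values are extended reals because [sigma] can be -oo, on a space with at
    most one point. *)
Lemma common_ratio (R : realType) (I : finType) (s : I -> \bar R) :
  (forall i, s i < 1)%E ->
  exists c : R, 0 <= c < 1 /\ (forall i, s i <= c%:E)%E.
Proof.
move=> s1; near (1 : R)^'- => c; exists c; split.
  by apply/andP; split; near: c; [apply: nbhs_left_ge|apply: nbhs_left_lt].
near: c; apply: filter_forall => i; have := s1 i; case: (s i) => [r r1|//|_].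
- near=> c; rewrite lee_fin; near: c; exact: nbhs_left_ge.
- by near=> c; rewrite leNye.
Unshelve. all: by end_near. Qed.

Lemma sigma_lipschitz (R : realType) (X : metricType R) (w : X -> X) (c : R) :
  (sigma w <= c%:E)%E ->
  forall x y, mdist (w x) (w y) <= c * mdist x y.
Proof.
move=> wc x y; have [<-|/eqP xy] := eqVneq x y; first by rewrite !mdistxx mulr0.
have d0 : 0 < mdist x y by rewrite mdist_gt0; exact/eqP.
rewrite -ler_pdivrMr// -lee_fin; apply: le_trans wc.
by apply: ereal_sup_ubound; exists (x, y).
Qed.

(** * Compact sets and nonexpansive maps in a metric space *)

Section metric_facts.
Context {R : realType} {X : metricType R}.
Implicit Types (A : set X) (x y z : X).

Lemma compact_dist_bounded A x : compact A ->
  exists M : R, forall y, A y -> mdist x y <= M.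
Proof.
move=> /compact_near_coveringP/(_ R +oo (fun M y => mdist x y <= M) _) cA.
have {}cA : \forall M \near +oo, forall y, A y -> mdist x y <= M.
  apply: cA => y _.
  exists ([set z | mdist y z < 1], [set M | mdist x y + 1 <= M]) => /=.
    split; last by apply: nbhs_pinfty_ge; exact: num_real.
    by apply/metricType_numDomainType.nbhs_mdistP; exists 1; rewrite /= ?ltr01.
  move=> [z M] /= [yz xyM].
  by rewrite (le_trans (metric_triangle _ y _))// (le_trans _ xyM)// lerD2l ltW.
by near (pinfty_nbhs R) => M; exists M; near: M.
Unshelve. all: by end_near. Qed.

Lemma compact2_dist_bounded A B : A !=set0 -> compact A -> compact B ->
  exists M : R, forall y z, A y -> B z -> mdist y z <= M.
Proof.
move=> [a Aa] /(@compact_dist_bounded _ a)[M AM].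
move=> /(@compact_dist_bounded _ a)[M' BM].
exists (M + M') => y z Ay Bz; rewrite (le_trans (metric_triangle _ a _))//.
by rewrite lerD// ?BM// metric_sym AM.
Qed.

(** If f_n is close to g at x, then it is nearly as close on a whole
    neighbourhood of x, for the same indices n, because the maps are
    nonexpansive; compactness of A makes the choice of n uniform. *)
Lemma nonexpansive_cvg_uniform (A : set X) (f : nat -> X -> X) (g : X -> X) :
  compact A ->
  (forall n x y, mdist (f n x) (f n y) <= mdist x y) ->
  (forall x y, mdist (g x) (g y) <= mdist x y) ->
  (forall x, f n x @[n --> \oo] --> g x) ->
  forall e, 0 < e ->
  \forall n \near \oo, forall x, A x -> mdist (g x) (f n x) <= e.
Proof.
move=> /compact_near_coveringP cA fL gL fg e e0.
have e3 : 0 < e / 3 by rewrite divr_gt0.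
apply: (cA nat \oo (fun n x => mdist (g x) (f n x) <= e)) => x _.
exists ([set y | mdist x y < e / 3], [set n | mdist (g x) (f n x) < e / 3]) => /=.
  split; last exact: (metricType_numDomainType.cvgr_dist_lt (fg x) e3).
  by apply/metricType_numDomainType.nbhs_mdistP; exists (e / 3).
move=> [y n] /= [xy gf].
have := metric_triangle (g y) (g x) (f n y).
have := metric_triangle (g x) (f n x) (f n y).
have := fL n x y; have := gL y x; rewrite (metric_sym y).
by move: xy gf; set a := mdist x y; lra.
Qed.

Lemma homeomorphism_open (f : X -> X) (O : set X) :
  homeomorphism f -> open O -> open (f @` O).
Proof.
move=> [_ [g [fg gf cg]]] oO.
suff -> : f @` O = g @^-1` O by apply: open_comp => // x _; exact: cg.
apply/seteqP; split => [_ [x Ox <-]|x Ogx]; first by rewrite /= fg.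
by exists (g x).
Qed.

Lemma cvg_dist_le (u v : nat -> X) x y (e : R) :
  u n @[n --> \oo] --> x -> v n @[n --> \oo] --> y ->
  (\forall n \near \oo, mdist (u n) (v n) <= e) -> mdist x y <= e.
Proof.
move=> ux vy uv; apply/ler_addgt0Pl => d d0.
near \oo => n.
have h1 : mdist x (u n) < d / 2.
  by near: n; apply: (metricType_numDomainType.cvgr_dist_lt ux); rewrite divr_gt0.
have h2 : mdist y (v n) < d / 2.
  by near: n; apply: (metricType_numDomainType.cvgr_dist_lt vy); rewrite divr_gt0.
have h3 : mdist (u n) (v n) <= e by near: n.
have := metric_triangle x (u n) y; have := metric_triangle (u n) (v n) y.
by rewrite (metric_sym (v n) y); lra.
Unshelve. all: by end_near. Qed.

End metric_facts.

(** * Lipschitz constants of a system *)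

Section systems.
Context {R : realType} {X : metricType R} {N : nat}.
Implicit Types (w : contr_system X N) (A : set X) (c : R).

Definition system_lipschitz w c :=
  forall i x y, mdist (w i x) (w i y) <= c * mdist x y.

Lemma contr_system_lipschitz w : exists2 c, 0 <= c < 1 & system_lipschitz w c.
Proof.
have [c [c01 wc]] := common_ratio (fun i => contr_homeo_contracting (w i)).
by exists c => // i; exact: sigma_lipschitz.
Qed.

(** * Existence of the attractor *)

Section address.
Variables (w : contr_system X N) (x0 : X).

(** The finite approximations w_(s 0) (w_(s 1) (... (w_(s (n-1)) x0))) of the
    point of the attractor with address s. *)
Fixpoint address_pt n (s : nat -> 'I_N) : X :=
  if n is n'.+1 then w (s 0%N) (address_pt n' (s \o succn)) else x0.

(** If every w_i moves x0 by at most K, the bound is the fixed point K / (1 - c)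
    of M |-> K + c M. *)
Lemma address_pt_bounded c : 0 <= c < 1 -> system_lipschitz w c ->
  exists M : R, forall n s, mdist x0 (address_pt n s) <= M.
Proof.
move=> /andP[c0 c1] wc.
near (pinfty_nbhs R) => K.
have K0 : 0 <= K by near: K; apply: nbhs_pinfty_ge; exact: num_real.
have wK i : mdist x0 (w i x0) <= K.
  move: i; near: K; apply: filter_forall => i.
  by apply: nbhs_pinfty_ge; exact: num_real.
have c'0 : 0 < 1 - c by rewrite subr_gt0.
exists (K / (1 - c)) => n; elim: n => [|n IH] s /=.
  by rewrite mdistxx divr_ge0// ltW.
apply: le_trans (metric_triangle _ (w (s 0%N) x0) _) _.
have -> : K / (1 - c) = K + c * (K / (1 - c)).
  by field; rewrite gt_eqF.
by rewrite lerD// (le_trans (wc _ _ _))// ler_wpM2l.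
Unshelve. all: by end_near. Qed.

(** The n common letters contract by c^n the distance between two points that
    are both within M of x0.  With s = t this says that the approximations form a
    Cauchy sequence; in general it says that their limit depends continuously on
    the address. *)
Lemma address_pt_close c M : 0 <= c -> system_lipschitz w c ->
  (forall n s, mdist x0 (address_pt n s) <= M) ->
  forall n k l s t, (forall m, (m < n)%N -> s m = t m) ->
  mdist (address_pt (n + k) s) (address_pt (n + l) t) <= c ^+ n * (M + M).
Proof.
move=> c0 wc pM; elim=> [|n IH] k l s t st.
  rewrite expr0 mul1r (le_trans (metric_triangle _ x0 _))// lerD//.
  by rewrite metric_sym.
rewrite /= st// (le_trans (wc _ _ _))// exprS -mulrA ler_wpM2l//.
by apply: IH => m mn; exact: st.
Qed.

Hypothesis X_complete : complete_space X.

Lemma address_pt_cvg s : exists x : X, address_pt n s @[n --> \oo] --> x.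
Proof.
have [c /[dup] c01 /andP[c0 _] wc] := contr_system_lipschitz w.
have [M pM] := address_pt_bounded c01 wc.
apply: X_complete; apply: cauchy_exP => e e0.
have e2 : 0 < e / 2 by rewrite divr_gt0.
have [n ne] := geometric_small (M + M) c01 e2.
exists (address_pt n s); exists n => // m /= /subnKC <-.
rewrite ballEmdist /=.
have := @address_pt_close _ _ c0 wc pM n 0 (m - n) s s (fun _ _ => erefl).
by rewrite addn0; move: e0 ne; lra.
Qed.

End address.

(** The limits of the approximations define the address map from the infinite
    words to X; it is continuous on the product of countably many finite
    discrete spaces, which is compact by Tychonoff's theorem.  Its range is
    self-similar since removing the first letter i of an address undoes w_i. *)
Lemma attractor_exists w (x0 : X) : complete_space X -> (0 < N)%N ->
  exists A, is_attractor w A.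
Proof.
move=> X_complete N_gt0.
have [c /[dup] c01 /andP[c0 _] wc] := contr_system_lipschitz w.
have [M pM] := address_pt_bounded x0 c01 wc.
have [code codeP] := choice (address_pt_cvg w x0 X_complete).
have code_close n s t : (forall m, (m < n)%N -> s m = t m) ->
    mdist (code s) (code t) <= c ^+ n * (M + M).
  move=> st; apply: cvg_dist_le (codeP s) (codeP t) _.
  exists n => // m /= /subnKC <-; exact: address_pt_close pM _ _ _ _ _ _.
have codeS s : code s = w (s 0%N) (code (s \o succn)).
  have [wcont _] := contr_homeo_homeo (w (s 0%N)).
  have h1 : address_pt w x0 n.+1 s @[n --> \oo] --> code s.
    apply: cvg_comp (codeP s) => P [k _ kP]; exists k => // n /= kn.
    by apply: kP => /=; exact: leqW.
  have h2 :
      address_pt w x0 n.+1 s @[n --> \oo] --> w (s 0%N) (code (s \o succn)).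
    exact: (continuous_cvg _ (wcont _) (codeP _)).
  exact: (cvg_unique (@metric_hausdorff _ X) h1 h2).
exists (range code); split.
- by exists (code (fun=> Ordinal N_gt0)); exists (fun=> Ordinal N_gt0).
- pose D : nat -> topologicalType := fun=> discrete_topology 'I_N.
  have cD : compact [set: prod_topology D].
    have := @tychonoff nat D (fun=> setT)
      (fun n => @finite_compact (discrete_topology 'I_N) _ finite_finset).
    by congr compact; apply/seteqP; split.
  have agree n (s : prod_topology D) :
      \forall t \near s, forall m, (m < n)%N -> t m = s m :> 'I_N.
    have FF : Filter (nbhs s) by exact: nbhs_filter.
    elim: n => [|n IH]; first exact: filterE.
    have sn : \forall t \near s, t n = s n :> 'I_N.
      apply: (@proj_continuous _ D n s [set s n]).
      exact: (@discrete_set1 (discrete_topology 'I_N) (s n)).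
    apply: (@filterS2 _ _ FF _ _ _ _ IH sn) => t st stn m; rewrite ltnS leq_eqVlt.
    by case/predU1P => [->//|]; exact: st.
  have code_continuous : continuous (code : prod_topology D -> X).
    move=> s; have FF : Filter (nbhs s) by exact: nbhs_filter.
    apply: (@metricType_numDomainType.cvgrPdist_lt _ _ _ _ FF _ _).2 => e e0.
    have e2 : 0 < e / 2 by rewrite divr_gt0.
    have [n ne] := geometric_small (M + M) c01 e2.
    apply: (@filterS _ _ FF _ _ _ (agree n s)) => t /code_close.
    by rewrite metric_sym; move: e0 ne; lra.
  apply: continuous_compact cD.
  exact: continuous_subspaceT.
- apply/seteqP; split => [_ [s _ <-]|_ [i _ [_ [s _ <-] <-]]].
    exists (s 0%N) => //; rewrite codeS.
    by exists (code (s \o succn)) => //; exists (s \o succn).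
  by exists (fun n => if n is n'.+1 then s n' else i) => //; rewrite codeS.
Qed.

(** * Word maps *)

Lemma word_map_cat w (s t : seq 'I_N) x :
  word_map w (s ++ t) x = word_map w s (word_map w t x).
Proof. by elim: s => //= i s ->. Qed.

Lemma word_map_lipschitz w c s : 0 <= c -> system_lipschitz w c ->
  forall x y, mdist (word_map w s x) (word_map w s y) <= c ^+ size s * mdist x y.
Proof.
move=> c0 wc x y; elim: s => [|i s IH] /=; first by rewrite expr0 mul1r.
by rewrite (le_trans (wc _ _ _))// exprS -mulrA ler_wpM2l.
Qed.

Lemma word_map_nonexpansive w s x y :
  mdist (word_map w s x) (word_map w s y) <= mdist x y.
Proof.
have [c /andP[c0 c1] wc] := contr_system_lipschitz w.
rewrite (le_trans (word_map_lipschitz s c0 wc x y))// ler_piMl ?mdist_ge0//.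
by rewrite exprn_ile1// ltW.
Qed.

Lemma word_map_open w s (O : set X) : open O -> open (word_map w s @` O).
Proof.
move=> oO; elim: s => [|i s IH] /=; first by rewrite image_id.
rewrite -(image_comp (word_map w s) (w i)).
exact: homeomorphism_open (contr_homeo_homeo (w i)) IH.
Qed.

Lemma attractor_word_map w A s x : is_attractor w A -> A x -> A (word_map w s x).
Proof.
move=> [_ _ wA] Ax; elim: s => [|i s IH] //=.
by rewrite wA; exists i => //; exists (word_map w s x).
Qed.

Lemma attractor_word_preimage w A n x : is_attractor w A -> A x ->
  exists s : n.-tuple 'I_N, exists2 y, A y & word_map w s y = x.
Proof.
move=> [_ _ wA]; elim: n x => [|n IH] x; first by exists [tuple], x.
rewrite {1}wA => -[i _ [x' /IH[s [y Ay <-]] <-]].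
by exists [tuple of i :: s], y.
Qed.

(** * Continuity of the attractor *)

(** Comparing A = U w_i(A) with B = U v_i(B) letter by letter, a bound D on the
    distance from A to B and back improves to c D + e (1 - c), whose fixed point
    is e.  After finitely many steps from any initial bound M, the distance is
    at most 2e. *)
Lemma attractor_approx w v A B c e :
  0 <= c < 1 -> system_lipschitz v c -> 0 < e ->
  is_attractor w A -> is_attractor v B ->
  (forall i a, A a -> mdist (w i a) (v i a) <= e * (1 - c)) ->
  (forall a, A a -> exists2 b, B b & mdist a b <= e + e) /\
  (forall b, B b -> exists2 a, A a & mdist a b <= e + e).
Proof.
move=> /[dup] c01 /andP[c0 _] vc e0 [[a0 Aa0] cA wA] [[b0 Bb0] cB vB] wv.
have [M ABM] := compact2_dist_bounded (ex_intro _ a0 Aa0) cA cB.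
have [n ne] := geometric_small M c01 e0.
suff [AB BA] : (forall a, A a -> exists2 b, B b & mdist a b <= c ^+ n * M + e) /\
               (forall b, B b -> exists2 a, A a & mdist a b <= c ^+ n * M + e).
  split=> [a /AB[b Bb ab]|b /BA[a Aa ab]].
    by exists b => //; rewrite (le_trans ab)// lerD2r.
  by exists a => //; rewrite (le_trans ab)// lerD2r.
have step a b i r : A a -> mdist a b <= r + e ->
    mdist (w i a) (v i b) <= c * r + e.
  move=> Aa ab; have := metric_triangle (w i a) (v i a) (v i b).
  have := wv i a Aa; have := vc i a b.
  by have := ler_wpM2l c0 ab; lra.
elim: n {ne} => [|n [IHA IHB]]; last rewrite exprS -mulrA.
  by split=> z ?; [exists b0|exists a0];
    rewrite // expr0 mul1r ler_wpDr ?ABM// ltW.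
split=> z.
- rewrite wA => -[i _ [a Aa <-]]; have [b Bb ab] := IHA a Aa.
  by exists (v i b); [rewrite vB; exists i => //; exists b|exact: step].
- rewrite vB => -[i _ [b Bb <-]]; have [a Aa ab] := IHB b Bb.
  by exists (w i a); [rewrite wA; exists i => //; exists a|exact: step].
Qed.

Lemma system_cvg_lipschitz (u : nat -> contr_system X N) w :
  (forall i, strongly_pointwise_cvg (u ^~ i) (w i)) ->
  exists2 c, 0 <= c < 1 & forall m, system_lipschitz (u m) c.
Proof.
move=> uw; have [c [c01 uc]] := common_ratio (fun i => (uw i).2).
exists c => // m i; apply: sigma_lipschitz; apply: le_trans (uc i).
by apply: ereal_sup_ubound; exists m.
Qed.

Lemma word_map_cvg (u : nat -> contr_system X N) w s :
  (forall i, strongly_pointwise_cvg (u ^~ i) (w i)) ->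
  forall x, word_map (u m) s x @[m --> \oo] --> word_map w s x.
Proof.
move=> uw x; elim: s => [|i s IH] /=; first exact: cvg_cst.
apply/metricType_numDomainType.cvgrPdist_lt => e e0.
have e2 : 0 < e / 2 by rewrite divr_gt0.
near=> m.
have h1 : mdist (word_map w s x) (word_map (u m) s x) < e / 2.
  by near: m; exact: metricType_numDomainType.cvgr_dist_lt.
have h2 : mdist (w i (word_map w s x)) (u m i (word_map w s x)) < e / 2.
  by near: m; exact: (metricType_numDomainType.cvgr_dist_lt ((uw i).1 _) e2).
apply: le_lt_trans (metric_triangle _ (u m i (word_map w s x)) _) _.
have := word_map_nonexpansive (u m) [:: i] (word_map w s x) (word_map (u m) s x).
by move=> /=; lra.
Unshelve. all: by end_near. Qed.

(** * Separated points *)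

Definition separated w n (x : X) (r : R) :=
  forall i j : n.-tuple 'I_N, i <> j -> forall y, attractor w y ->
  r <= mdist (word_map w i x) (word_map w j y).

Definition has_separated_point n : set (contr_system X N) :=
  [set w | exists x r, [/\ attractor w x, 0 < r & separated w n x r]].

(** A point w_j(y) with y in A is also w_(jl)(z) for some word l of length m, and
    the words ik and jl differ as soon as i and j do. *)
Lemma separated_word_map w n m x r (k : m.-tuple 'I_N) :
  is_attractor w (attractor w) ->
  separated w (n + m) x r -> separated w n (word_map w k x) r.
Proof.
move=> Aw sepx i j ij y /(attractor_word_preimage m Aw)[l [z Az <-]].
rewrite -!word_map_cat; apply: (sepx [tuple of i ++ k] [tuple of j ++ l]) => //.
move=> /(congr1 (take n \o val)) /=.
by rewrite !take_size_cat ?size_tuple// => /val_inj.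
Qed.

(** Word maps send open sets to open sets, so each w_i(O) contains a ball around
    w_i(x); the constant is a common radius for the finitely many words i. *)
Lemma SMP_has_separated_point w : is_attractor w (attractor w) ->
  SMP w -> forall n, (0 < n)%N -> has_separated_point n w.
Proof.
move=> [[a Aa] _ _] smp n /smp[ O [oO clO Odisj]].
have /(_ setT filterT) [x [[Ox Ax] _]] : closure (O `&` attractor w) a.
  by rewrite clO.
exists x.
have : \forall r \near (0 : R)^'+, forall (i : n.-tuple 'I_N) y,
    mdist (word_map w i x) y < r -> (word_map w i @` O) y.
  apply: filter_forall => i.
  have /metricType_numDomainType.nbhs_mdistP[r /= r0 irO] :
      nbhs (word_map w i x) (word_map w i @` O).
    by apply: open_nbhs_nbhs; split; [exact: word_map_open|exists x].
  near=> t => y iy; apply: irO => /=; apply: lt_le_trans iy _.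
  by near: t; exact: nbhs_right_le.
move=> rO; near ((0 : R)^'+) => r; exists r; split => //.
move=> i j ij y Ay; rewrite leNgt; apply/negP => xyr.
(* Points within d of y are sent by w_j into the ball of radius r at w_i(x). *)
pose d := r - mdist (word_map w i x) (word_map w j y).
have : closure (O `&` attractor w) y by rewrite clO.
have /[swap] /[apply] : nbhs y (ball y d) by apply: nbhsx_ballx; rewrite subr_gt0.
rewrite ballEmdist => -[z [[Oz _] /= yz]].
have iz : (word_map w i @` O) (word_map w j z).
  have rO' : forall (i : n.-tuple 'I_N) y,
    mdist (word_map w i x) y < r -> (word_map w i @` O) y by near: r.
  apply: rO'; apply: le_lt_trans (metric_triangle _ (word_map w j y) _) _.
  by have := word_map_nonexpansive w j y z; move: yz; rewrite /d; lra.
have : (word_map w i @` O `&` word_map w j @` O) (word_map w j z).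
  by split => //; exists z.
by rewrite Odisj.
Unshelve. all: by end_near. Qed.

(** A point a = w_k(a') of A, with k of length m, is within c^m diam(A) of w_k(x),
    where x is an (n+m)-separated point. *)
Lemma separated_dense w n : is_attractor w (attractor w) ->
  (forall m, has_separated_point (n + m) w) ->
  forall a e, attractor w a -> 0 < e ->
  exists z r, [/\ attractor w z, 0 < r, separated w n z r & mdist a z < e].
Proof.
move=> Aw sepw a e Aa e0.
have [c /[dup] c01 /andP[c0 _] wc] := contr_system_lipschitz w.
have [A0 cA _] := Aw.
have [M AM] := compact2_dist_bounded A0 cA cA.
have e2 : 0 < e / 2 by rewrite divr_gt0.
have [m me] := geometric_small M c01 e2.
have [k [a' Aa' <-]] := attractor_word_preimage m Aw Aa.
have [x [r [Ax r0 sepx]]] := sepw m.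
exists (word_map w k x), r; split => //.
- exact: attractor_word_map.
- exact: separated_word_map.
have := word_map_lipschitz k c0 wc a' x; rewrite size_tuple.
have := ler_wpM2l (exprn_ge0 m c0) (AM _ _ Aa' Ax).
by move: e0 me; lra.
Qed.

Lemma has_separated_point_SMP w : is_attractor w (attractor w) ->
  (forall n, has_separated_point n.+1 w) -> SMP w.
Proof.
move=> Aw sepw [//|n] _.
(* With radius r around a point separated by 2r, balls of radii r and s satisfy
   r + s <= max(2r, 2s), so the images of their points stay apart. *)
pose O := \bigcup_(p in [set p : X * R |
  [/\ attractor w p.1, 0 < p.2 & separated w n.+1 p.1 (p.2 + p.2)]])
    [set y | mdist p.1 y < p.2].
exists O; split.
- apply: bigcup_open => -[x r] [/= _ r0 _].
  rewrite openE => y /= xy.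
  apply/metricType_numDomainType.nbhs_mdistP.
  exists (r - mdist x y) => /=; first by rewrite subr_gt0.
  by move=> z /= yz; have := metric_triangle x y z; lra.
- have cA : closed (attractor w).
    by have [_ cA _] := Aw; exact: compact_closed (@metric_hausdorff _ X) cA.
  apply/seteqP; split => [x|a Aa].
    by rewrite {2}((closure_id _).1 cA); apply: closure_subset; exact: subIsetr.
  move=> B /metricType_numDomainType.nbhs_mdistP[e /= e0 aB].
  have [z [r [Az r0 sepz az]]] :=
    @separated_dense w n.+1 Aw (fun m => sepw (n + m)%N) _ _ Aa e0.
  exists z; split; last by apply: aB.
  split=> //; exists (z, r / 2) => /=; last by rewrite mdistxx divr_gt0.
  by split; rewrite ?divr_gt0// -splitr.
- move=> i j ij; apply/seteqP; split => // _ [[p [[x r] [/= Ax r0 sepx] xp] <-]].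
  move=> [q [[y s] [/= Ay s0 sepy] /= yq]] jqip.
  have h1 := word_map_nonexpansive w i x p.
  have h2 := word_map_nonexpansive w j y q.
  have h3 := sepx i j ij y Ay.
  have h4 := sepy j i (nesym ij) x Ax.
  have := metric_triangle (word_map w i x) (word_map w i p) (word_map w j y).
  rewrite (metric_sym (word_map w j y) (word_map w i x)) in h4.
  rewrite -jqip (metric_sym (word_map w j q)).
  by rewrite -jqip in h1; move: xp; lra.
Qed.

(** With e = r / 12, approximating x and y costs 2e each and replacing a word map
    of w by one of u m costs e twice, so at most r / 2 of the constant is lost. *)
Lemma open_has_separated_point n :
  (forall w : contr_system X N, is_attractor w (attractor w)) ->
  open (has_separated_point n).
Proof.
move=> attrP; change (BN_open (has_separated_point n)).
move=> u w nsep_u uw [x [r [Ax r0 sepx]]].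
have [c /[dup] c01 /andP[_ c1] uc] := system_cvg_lipschitz uw.
have [_ cA _] := attrP w.
have unif (s : seq 'I_N) d : 0 < d -> \forall m \near \oo, forall a,
    attractor w a -> mdist (word_map w s a) (word_map (u m) s a) <= d.
  move: d; apply: (nonexpansive_cvg_uniform cA _ _ (word_map_cvg uw)).
  - by move=> m; exact: word_map_nonexpansive.
  - exact: word_map_nonexpansive.
pose e := r / 12.
have e0 : 0 < e by rewrite divr_gt0.
near (\oo : set_system nat) => m.
have letters i a : attractor w a -> mdist (w i a) (u m i a) <= e * (1 - c).
  move: i a; near: m; apply: filter_forall => i.
  by apply: (unif [:: i]); rewrite mulr_gt0// subr_gt0.
have words (i : n.-tuple 'I_N) a :
    attractor w a -> mdist (word_map w i a) (word_map (u m) i a) <= e.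
  by move: i a; near: m; apply: filter_forall => i; exact: unif.
have [AB BA] := attractor_approx c01 (uc m) e0 (attrP w) (attrP (u m)) letters.
have [x' Bx' xx'] := AB x Ax.
apply: (nsep_u m); exists x', (r / 2); split; rewrite ?divr_gt0//.
move=> i j ij y' /BA[y Ay yy'].
have hr := sepx i j ij y Ay.
have hi := words i x Ax.
have hj := words j y Ay.
have hx := word_map_nonexpansive (u m) i x x'.
have hy := word_map_nonexpansive (u m) j y y'.
have t1 :=
  metric_triangle (word_map w i x) (word_map (u m) i x) (word_map w j y).
have t2 :=
  metric_triangle (word_map (u m) i x) (word_map (u m) i x') (word_map w j y).
have t3 :=
  metric_triangle (word_map (u m) i x') (word_map (u m) j y') (word_map w j y).
have t4 :=
  metric_triangle (word_map (u m) j y') (word_map (u m) j y) (word_map w j y).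
rewrite (metric_sym (word_map (u m) j y') (word_map (u m) j y)) in t4.
rewrite (metric_sym (word_map (u m) j y) (word_map w j y)) in t4.
by move: xx' yy'; rewrite /e in hi hj *; lra.
Unshelve. all: by end_near. Qed.

End systems.

Theorem theorem2 (R : realType) (X : metricType R) (N : nat)
    (X_complete : complete_space X) (N_gt0 : (0 < N)%N) :
  Gdelta [set w : contr_system X N | SMP w].
Proof.
have [[x0]|X0] := pselect (inhabited X); last first.
  (* The empty space carries no attractor: [attractor] is then the empty set,
     and the empty open set witnesses SMP for every system. *)
  have noX (x : X) : False by apply: X0; exists.
  apply: open_Gdelta; rewrite (_ : [set w | _] = setT); first exact: openT.
  apply/seteqP; split => // w _ n _; exists set0; split.
  - exact: open0.
  - by apply/seteqP; split => x; case: (noX x).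
  - by move=> i j _; apply/seteqP; split => x; case: (noX x).
have attrP (w : contr_system X N) : is_attractor w (attractor w).
  by rewrite /attractor; apply: xgetPex; exact: attractor_exists.
exists (fun n => has_separated_point n.+1).
  by move=> n; exact: open_has_separated_point.
apply/seteqP; split => [w smp n _|w sepw].
  exact: SMP_has_separated_point.
by apply: has_separated_point_SMP => // n; exact: sepw.
Qed.
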